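(* The logic $\mathsf{ITL^p}$ does not have the finite model property; that is, there is a formula that is valid over all finite persistent models but is not in $\mathsf{ITL^p}$.
   Context: Formulas: $\varphi::= p\mid\bot\mid\varphi\wedge\varphi\mid\varphi\vee\varphi\mid\varphi\to\varphi\mid\bigcirc\varphi\mid\Diamond\varphi\mid\Box\varphi$, $p$ in a countable set $\mathbb P$. A model is $(W,\preccurlyeq,S,V)$ with $W\ne\emptyset$, $\preccurlyeq$ a partial order, $S\colon W\to W$ forward confluent ($w\preccurlyeq v\Rightarrow S(w)\preccurlyeq S(v)$), and $V\colon W\to2^{\mathbb P}$ monotone ($w\preccurlyeq v\Rightarrow V(w)\subseteq V(v)$). It is persistent if moreover $S$ is backward confluent: whenever $v\succcurlyeq S(w)$ there is $u\succcurlyeq w$ with $v=S(u)$. Satisfaction, with $S^0(w)=w$, $S^{k+1}(w)=S(S^k(w))$: $w\models p$ iff $p\in V(w)$; $\bot$ never; $\wedge,\vee$ as usual; $w\models\varphi\to\psi$ iff for all $v\succcurlyeq w$, $v\models\varphi$ implies $v\models\psi$; $w\models\bigcirc\varphi$ iff $S(w)\models\varphi$; $w\models\Diamond\varphi$ iff $S^k(w)\models\varphi$ for some $k\ge0$; $w\models\Box\varphi$ iff $S^k(w)\models\varphi$ for all $k\ge 0$. $\mathsf{ITL^p}$ is the set of formulas true at every world of every persistent model. The finite model property for $\mathsf{ITL^p}$ would mean that every formula not in $\mathsf{ITL^p}$ is false at some world of some persistent model with finitely many worlds. *)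

(* Defs.v *)
From Stdlib Require Export PeanoNat Relations FinFun.

Inductive formula (P : Type) : Type :=
| Var (p : P)
| Bot
| And (phi psi : formula P)
| Or (phi psi : formula P)
| Imp (phi psi : formula P)
| Next (phi : formula P)
| Dia (phi : formula P)
| Box (phi : formula P).

Arguments Var {P} p.
Arguments Bot {P}.
Arguments And {P} phi psi.
Arguments Or {P} phi psi.
Arguments Imp {P} phi psi.
Arguments Next {P} phi.
Arguments Dia {P} phi.
Arguments Box {P} phi.

Record model (P : Type) : Type := Model {
  world : Type;
  le : world -> world -> Prop;
  succ : world -> world;
  val : world -> P -> Prop;
  world_inhabited : inhabited world;
  le_order : order world le;
  succ_forward_confluent : forall w v, le w v -> le (succ w) (succ v);
  val_monotone : forall w v, le w v -> forall p, val w p -> val v p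
}.

Arguments world {P} m.
Arguments le {P} m w v.
Arguments succ {P} m w.
Arguments val {P} m w p.

Definition persistent {P : Type} (M : model P) : Prop :=
  forall w v : world M, le M (succ M w) v ->
    exists u : world M, le M w u /\ v = succ M u.

Fixpoint sat {P : Type} (M : model P) (w : world M) (phi : formula P) : Prop :=
  match phi with
  | Var p => val M w p
  | Bot => False
  | And phi psi => sat M w phi /\ sat M w psi
  | Or phi psi => sat M w phi \/ sat M w psi
  | Imp phi psi => forall v : world M, le M w v -> sat M v phi -> sat M v psi
  | Next phi => sat M (succ M w) phi
  | Dia phi => exists k : nat, sat M (Nat.iter k (succ M) w) phi
  | Box phi => forall k : nat, sat M (Nat.iter k (succ M) w) phi
  end.

Definition ITLp {P : Type} (phi : formula P) : Prop :=
  forall M : model P, persistent M -> forall w : world M, sat M w phi.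

Definition valid_finite_persistent {P : Type} (phi : formula P) : Prop :=
  forall M : model P, persistent M -> Finite (world M) ->
    forall w : world M, sat M w phi.

Definition ITLp_fmp (P : Type) : Prop :=
  forall phi : formula P, ~ ITLp phi ->
    exists M : model P, persistent M /\ Finite (world M) /\
      exists w : world M, ~ sat M w phi.

(* Main.v *)
From Stdlib Require Import Classical List Lia.
Require Import Defs.

(** The formula is [~~<>[]p -> <>~~[]p]. In a finite persistent model there is a
    uniform [K] such that [S^K u] satisfies [[]p] for every [u] satisfying [<>[]p];
    backward confluence of [S^K] then moves [~~<>[]p] at [w] to [~~[]p] at [S^K w].
    It fails at the root of the infinite model in which a fixed root lies below
    incomparable points [u_0, u_1, ...] with [S u_(n+1) = u_n], [S u_0 = u_0], and
    [p] true only at [u_0]: no single number of steps brings all [u_n] to [u_0]. *)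

Definition Neg {P : Type} (phi : formula P) : formula P := Imp phi Bot.

Definition dns_Dia_Box {P : Type} (phi : formula P) : formula P :=
  Imp (Neg (Neg (Dia (Box phi)))) (Dia (Neg (Neg (Box phi)))).

Section Iterates.

Context {P : Type} (M : model P).

Lemma le_iter_succ (k : nat) (w v : world M) :
  le M w v -> le M (Nat.iter k (succ M) w) (Nat.iter k (succ M) v).
Proof.
  intros Hwv; induction k as [|k IH]; simpl; auto.
  now apply succ_forward_confluent.
Qed.

Lemma persistent_iter (k : nat) (w v : world M) :
  persistent M -> le M (Nat.iter k (succ M) w) v ->
  exists u : world M, le M w u /\ v = Nat.iter k (succ M) u.
Proof.
  intros HM; revert v; induction k as [|k IH]; simpl; intros v Hv; [now exists v|].
  destruct (HM _ _ Hv) as [v' [Hv' ->]].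
  destruct (IH _ Hv') as [u [Hu ->]].
  now exists u.
Qed.

Lemma sat_Box_iter (phi : formula P) (j k : nat) (w : world M) :
  j <= k -> sat M (Nat.iter j (succ M) w) (Box phi) ->
  sat M (Nat.iter k (succ M) w) (Box phi).
Proof.
  simpl; intros Hjk H i.
  rewrite <- Nat.iter_add.
  replace (i + k) with ((i + k - j) + j) by lia.
  rewrite Nat.iter_add.
  apply H.
Qed.

(** Once [Box phi] holds on an orbit it holds at all later points, so the maximum of finitely many
    witnesses serves every world of [l]. *)
Lemma sat_Dia_Box_uniform (phi : formula P) (l : list (world M)) :
  exists K : nat, forall w, In w l -> sat M w (Dia (Box phi)) ->
    sat M (Nat.iter K (succ M) w) (Box phi).
Proof.
  induction l as [|v l [K IH]]; [now exists 0|].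
  destruct (classic (sat M v (Dia (Box phi)))) as [[k Hk]|Hv].
  - exists (max k K); intros w [->|Hw] Hsat.
    + apply (sat_Box_iter phi k); [lia|exact Hk].
    + apply (sat_Box_iter phi K); [lia|auto].
  - exists K; intros w [->|Hw] Hsat; [contradiction|auto].
Qed.

End Iterates.

Lemma dns_Dia_Box_valid_finite {P : Type} (phi : formula P) :
  valid_finite_persistent (dns_Dia_Box phi).
Proof.
  intros M HM [l Hl] w0 w _ Hw.
  destruct (sat_Dia_Box_uniform M phi l) as [K HK].
  exists K; intros v Hv Hnot.
  destruct (persistent_iter M K w v HM Hv) as [v' [Hv' ->]].
  (* It suffices to refute [Dia (Box phi)] at every [u] above [v']: otherwise [S^K u], which lies
     above [S^K v'], would satisfy [Box phi], against [Hnot]. *)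
  apply (Hw v' Hv'); intros u Hu Hsat.
  apply (Hnot (Nat.iter K (succ M) u)); [now apply le_iter_succ|].
  apply HK; [apply Hl|exact Hsat].
Qed.

(* [None] is the root and [Some n] is the point [u_n]. *)
Definition fan_model (P : Type) : model P.
Proof.
  refine {| world := option nat;
            le := fun a b => a = None \/ a = b;
            succ := option_map Nat.pred;
            val := fun a _ => a = Some 0 |}.
  - exact (inhabits None).
  - split; red; intuition congruence.
  - intros w v [->| ->]; auto.
  - intros w v [->| ->] p; easy.
Defined.

Lemma fan_model_persistent (P : Type) : persistent (fan_model P).
Proof.
  intros [n|] v Hv; simpl in *.
  - destruct Hv as [Hv|<-]; [discriminate|].
    now exists (Some n); split; [right|].
  (* The root is fixed and lies below everything, so any preimage of [v] will do; the index shift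
     supplies one. *)
  - exists (option_map S v); split; [now left|now destruct v].
Qed.

Lemma fan_model_iter_None (P : Type) (k : nat) :
  Nat.iter k (succ (fan_model P)) None = None.
Proof. now induction k as [|k IH]; simpl in *; [|rewrite IH]. Qed.

Lemma fan_model_iter_Some (P : Type) (k n : nat) :
  Nat.iter k (succ (fan_model P)) (Some n) = Some (n - k).
Proof.
  induction k as [|k IH]; simpl in *; [now rewrite Nat.sub_0_r|].
  rewrite IH; simpl; f_equal; lia.
Qed.

Lemma dns_Dia_Box_not_ITLp {P : Type} (p : P) : ~ ITLp (dns_Dia_Box (Var p)).
Proof.
  intros H.
  destruct (H (fan_model P) (fan_model_persistent P) None None) as [k Hk].
  - now left.
  - assert (Hdia : forall n, sat (fan_model P) (Some n) (Dia (Box (Var p)))).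
    { intros n; exists n; intros i.
      rewrite !fan_model_iter_Some; simpl; f_equal; lia. }
    (* Each world above the root has some [u_n] above it: itself, or [u_0] in the case of the
       root. *)
    intros [n|] _ Hnot.
    + apply (Hnot (Some n)); [now right|apply Hdia].
    + apply (Hnot (Some 0)); [now left|apply Hdia].
  - rewrite fan_model_iter_None in Hk.
    (* [u_1] is maximal and [p] fails there, so it satisfies [Neg (Box p)]; it lies above the root,
       which [S^k] fixes for every [k]. *)
    apply (Hk (Some 1)); [now left|].
    intros v [Hv|<-] Hbox; [discriminate|].
    discriminate (Hbox 0).
Qed.

Theorem theorem12 (P : Type) (P_nonempty : inhabited P)
    (P_countable : exists f : P -> nat, Injective f) :
  ~ ITLp_fmp P /\
  exists phi : formula P, valid_finite_persistent phi /\ ~ ITLp phi.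
Proof.
  destruct P_nonempty as [p].
  pose proof (dns_Dia_Box_valid_finite (Var p)) as Hfin.
  pose proof (dns_Dia_Box_not_ITLp p) as Hnot.
  split; [|now exists (dns_Dia_Box (Var p))].
  intros Hfmp.
  destruct (Hfmp _ Hnot) as [M [HM [HMfin [w Hw]]]].
  exact (Hw (Hfin M HM HMfin w)).
Qed.
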